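(* Let $p,q$ be primes with $p>2$, $q\equiv 1\pmod p$ and $q\not\equiv 1\pmod{p^2}$, and let $r$ be a fixed element of order $p$ in $\mathbb{Z}_q^\times$. Up to isomorphism, the left braces with additive group isomorphic to $\mathbb{Z}_p^2\times\mathbb{Z}_q$ and with $|\ker\lambda|=pq$ are exactly the braces $B_{i,j}$ for $0\le i,j\le 1$, $(i,j)\neq(0,0)$, distinct pairs giving non-isomorphic braces, where $B_{i,j}=(\mathbb{Z}_p\times\mathbb{Z}_p\times\mathbb{Z}_q,+,\circ)$ with $$\begin{pmatrix} n\\ m\\ l\end{pmatrix}+\begin{pmatrix} s\\ t\\ u\end{pmatrix}=\begin{pmatrix} n+s\\ m+t\\ l+u\end{pmatrix},\qquad \begin{pmatrix} n\\ m\\ l\end{pmatrix}\circ\begin{pmatrix} s\\ t\\ u\end{pmatrix}=\begin{pmatrix} n+s+jmt\\ m+t\\ l+r^{im}u\end{pmatrix}$$ for all $n,m,s,t\in\mathbb{Z}_p$ and $l,u\in\mathbb{Z}_q$. In particular, $(B_{i,j},\circ)\cong\mathbb{Z}_p^2\times\mathbb{Z}_q$ if $(i,j)=(0,1)$, and $(B_{i,j},\circ)\cong\mathbb{Z}_p\times(\mathbb{Z}_q\rtimes_r\mathbb{Z}_p)$ otherwise.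
   Context: A skew (left) brace is a triple $(B,+,\circ)$ where $(B,+)$ and $(B,\circ)$ are groups such that $a\circ(b+c)=a\circ b-a+a\circ c$ for all $a,b,c\in B$; it is a left brace if $(B,+)$ is abelian. The map $\lambda:(B,\circ)\to\mathrm{Aut}(B,+)$, $\lambda_a(b)=-a+a\circ b$, is a group homomorphism, with kernel $\ker\lambda$. Isomorphisms are bijections preserving both operations. $\mathbb{Z}_p\times(\mathbb{Z}_q\rtimes_r\mathbb{Z}_p)=\langle\sigma,\tau,\epsilon\mid\sigma^p=\tau^p=\epsilon^q=1,\ [\epsilon,\tau]=[\tau,\sigma]=1,\ \sigma\epsilon\sigma^{-1}=\epsilon^r\rangle$. *)

(* Defs.v *)
From HB Require Import structures.
From mathcomp Require Import all_boot all_order all_algebra all_fingroup.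
From mathcomp Require Import all_solvable.

Set Implicit Arguments.
Unset Strict Implicit.
Unset Printing Implicit Defensive.

Import GRing.Theory.
Local Open Scope ring_scope.

Declare Scope brace_scope.
Delimit Scope brace_scope with brace.

(* Left braces: the group (B, +) is abelian, i.e., a zmodType; [circ] is a    *)
(* second group law on the same carrier.                                      *)
HB.mixin Record Zmodule_isLeftBrace B of GRing.Zmodule B := {
  circ : B -> B -> B;
  circ_one : B;
  circ_inv : B -> B;
  circA : associative circ;
  circ1b : left_id circ_one circ;
  circVb : left_inverse circ_one circ_inv circ;
  circDr : forall a b c : B, circ a (b + c) = circ a b - a + circ a c
}.

#[short(type="leftBraceType")]
HB.structure Definition LeftBrace :=
  { B of GRing.Zmodule B & Zmodule_isLeftBrace B }.

Notation "a ∘ b" := (circ a b)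
  (at level 40, left associativity) : brace_scope.
Local Open Scope brace_scope.

#[short(type="finLeftBraceType")]
HB.structure Definition FinLeftBrace :=
  { B of LeftBrace B & Finite B }.

(* As for the ring structures of finalg, the finGroupType of B itself is      *)
(* (B, +).                                                                    *)
HB.instance Definition _ (B : finLeftBraceType) :=
  [finGroupMixin of B for +%R].

Definition circ_group (B : finLeftBraceType) : Type := B.
HB.instance Definition _ (B : finLeftBraceType) :=
  Finite.copy (circ_group B) B.
HB.instance Definition _ (B : finLeftBraceType) :=
  Finite_isGroup.Build (circ_group B) (@circA B) (@circ1b B) (@circVb B).

Definition lambda (B : leftBraceType) (a b : B) : B := - a + a ∘ b.

Definition lambda_ker (B : finLeftBraceType) : {set B} :=
  [set a | [forall b, lambda a b == b]].

Definition brace_isog (B C : leftBraceType) : Prop :=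
  exists f : B -> C,
    [/\ bijective f, {morph f : a b / a + b} & {morph f : a b / a ∘ b}].

Section BraceB.

(* The hypotheses make r ^+ m well defined for m in 'F_p.                     *)
Variables (p q : nat) (p_pr : prime p).
Variables (r : {unit 'F_q}) (r_order : #[r]%g = p) (i j : nat).

Definition braceB_carrier of prime p & #[r]%g = p & nat & nat : Type :=
  ('F_p * 'F_p * 'F_q)%type.
Local Notation T := (braceB_carrier p_pr r_order i j).

HB.instance Definition _ := Finite.copy T ('F_p * 'F_p * 'F_q)%type.
HB.instance Definition _ := GRing.Zmodule.copy T ('F_p * 'F_p * 'F_q)%type.

Definition braceB_circ (a b : T) : T :=
  let: (n, m, l) := a in
  let: (s, t, u) := b in
  (n + s + (m * t) *+ j, m + t, l + val (r ^+ (i * m))%g * u).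

Definition braceB_inv (a : T) : T :=
  let: (n, m, l) := a in
  (- n + (m * m) *+ j, - m, - (val (r ^+ (i * m))^-1%g * l)).

Let rXD (m t : 'F_p) :
  val (r ^+ (i * (m + t)%R))%g = val (r ^+ (i * m))%g * val (r ^+ (i * t))%g.
Proof.
have e : (m + t)%R = ((m + t)%N %% p)%N :> nat.
  by rewrite /=; congr (_ %% _)%N; apply: Fp_cast.
rewrite -FinRing.val_unitM -expgD -mulnDr; congr val; apply/eqP.
by rewrite eq_expg_mod_order r_order e modnMmr.
Qed.

Fact braceB_circA : associative braceB_circ.
Proof.
move=> [[n m] l] [[s t] u] [[s' t'] u'] /=; congr (_, _, _).
- rewrite mulrDl mulrDr !mulrnDl -!addrA; congr (_ + (_ + _)).
  by rewrite [RHS]addrCA; congr (_ + _); rewrite [LHS]addrC addrA.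
- exact: addrA.
- by rewrite rXD mulrDr mulrA addrA.
Qed.

Fact braceB_circ1 : left_id (0 : T) braceB_circ.
Proof.
move=> [[s t] u] /=; congr (_, _, _).
- by rewrite mul0r mul0rn add0r addr0.
- exact: add0r.
- by rewrite muln0 expg0 mul1r add0r.
Qed.

Fact braceB_circV : left_inverse (0 : T) braceB_inv braceB_circ.
Proof.
move=> [[n m] l] /=; congr (_, _, _).
- by rewrite mulNr mulNrn addrAC addrK addNr.
- exact: addNr.
- suff -> : (r ^+ (i * - m)%R = (r ^+ (i * m))^-1)%g by exact: addNr.
  apply: val_inj; apply: (mulrI (valP (r ^+ (i * m))%g)).
  by rewrite -rXD subrr muln0 expg0 -[RHS]FinRing.val_unitM mulgV.
Qed.

Fact braceB_circDr (a b c : T) :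
  braceB_circ a (b + c) = braceB_circ a b - a + braceB_circ a c.
Proof.
have subKA (V : zmodType) (x y z : V) : x + (y + z) = x + y - x + (x + z).
  by rewrite [RHS]addrA subrK addrA.
case: a b c => [[n m] l] [[s t] u] [[s' t'] u'] /=; congr (_, _, _) => /=.
- rewrite mulrDr mulrnDl -(addrA n) addrACA -(addrA n s) -(addrA n s').
  exact: subKA.
- exact: subKA.
- by rewrite mulrDr; apply: subKA.
Qed.

HB.instance Definition _ := Zmodule_isLeftBrace.Build T
  braceB_circA braceB_circ1 braceB_circV braceB_circDr.

Definition braceB : finLeftBraceType := T.

End BraceB.

(* Main.v *)
(* Let B be a left brace as in the classification and K the kernel of lambda.  *)
(* Since (B, o) / K has order p, every lambda_a has order dividing p. Choose   *)
(* e1, e3 in K of additive orders p and q, and e2 of additive order p outside  *)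
(* K. As lambda_{e2} preserves K and has p-th power 1, it fixes e1, sends e2   *)
(* to e2 + d e1 (the only p-th root of unity in F_p is 1) and multiplies e3 by *)
(* some c with c^p = 1. Since lambda_{k + b} = lambda_b for k in K, lambda_a   *)
(* for a = n e1 + m e2 + l e3 is the m-th power of lambda_{e2}, and so         *)
(* (n,m,l) o (s,t,u) = (n + s + d m t, m + t, l + c^m u). Here c is a power of *)
(* r, and rescaling e1 and e2 turns (d, c) into (j, r^i).                      *)
(* The B_ij are told apart by: i = 0 iff o is commutative, and j = 0 iff       *)
(* lambda is trivial on the p-torsion of (B, +). For odd p the cocycle m t is  *)
(* the coboundary of m^2 / 2, hence (B_ij, o) is isomorphic to (B_i0, o).      *)

Require Import Defs.
From mathcomp Require Import all_boot all_order all_algebra all_fingroup.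
From mathcomp Require Import all_solvable.
From mathcomp Require Import finfield ring.

Set Implicit Arguments.
Unset Strict Implicit.
Unset Printing Implicit Defensive.

Import GRing.Theory.
Local Open Scope ring_scope.
Local Open Scope brace_scope.

(** The kernel K of [lambda] is a subgroup of index p in both groups, and lambda_a depends only on
    the class of a modulo K ([lambda_kerDl]). The whole brace is thus encoded by one automorphism
    lambda_{e2} with trivial p-th power ([iter_lambda_index]). [brace_coordinates] writes it in a
    basis adapted to K, with parameters d and c, and [brace_isog_rescale] normalises them by a
    diagonal change of basis, which gives [brace_classification]. Two invariants,
    [braceB_commutative] and [braceB_torsion], recover i and j. For the multiplicative groups,
    [circ_braceB_isog] removes the cocycle m t by a quadratic shear, which needs 2 invertible mod p;
    [circ_braceB00_isog] and [circ_braceB10_Grp] identify what is left. *)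

(** * Powers and multiples with exponents in a prime field *)

Lemma mem_expg_indexg (gT : finGroupType) (G H : {group gT}) (x : gT) :
  (H <| G)%g -> x \in G -> (x ^+ #|G : H|)%g \in H.
Proof.
move=> /andP[_ nHG] Gx; have Nx := subsetP nHG x Gx.
apply: coset_idr; first exact: groupX.
by rewrite morphX // -card_quotient // expg_cardG // mem_quotient.
Qed.

Lemma mem_expg_coprime (gT : finGroupType) (H : {group gT}) (x : gT) m n :
  (0 < m)%N -> coprime m n -> (x ^+ m)%g \in H -> (x ^+ n)%g \in H -> x \in H.
Proof.
move=> m_gt0 /eqP co Hm Hn; case: (egcdnP n m_gt0) => km kn e _.
rewrite co addn1 in e; have : (x ^+ (kn * n).+1)%g \in H.
  by rewrite -e mulnC expgM groupX.
by rewrite expgSr mulnC expgM groupMl // groupX.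
Qed.

Lemma mulrn_coprime_eq0 (V : zmodType) (x : V) m n :
  (0 < m)%N -> coprime m n -> x *+ m = 0 -> x *+ n = 0 -> x = 0.
Proof.
move=> m_gt0 /eqP co xm xn; case: (egcdnP n m_gt0) => km kn e _.
have : x *+ (km * m) = 0 by rewrite mulnC mulrnA xm mul0rn.
by rewrite e co mulrnDr mulnC mulrnA xn mul0rn add0r.
Qed.

Section FpMultiples.

Variables (V : zmodType) (p : nat) (e : V).
Hypotheses (p_pr : prime p) (ep : e *+ p = 0).
Implicit Types a b : 'F_p.

(** An element of ['F_p] acts through its representative in [nat]; since p e = 0, the choice of
    representative does not matter. *)
Lemma mulrn_Fp_nat n : e *+ (n%:R : 'F_p) = e *+ n.
Proof.
by rewrite val_Fp_nat // {2}(divn_eq n p) mulrnDr mulnC mulrnA ep mul0rn add0r.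
Qed.

Lemma mulrn_FpD a b : e *+ (a + b)%R = e *+ a + e *+ b.
Proof. by rewrite -[RHS]mulrnDr -[RHS]mulrn_Fp_nat natrD !natr_Zp. Qed.

Lemma mulrn_FpM a b : e *+ (a * b)%R = e *+ a *+ b.
Proof. by rewrite -[RHS]mulrnA -[RHS]mulrn_Fp_nat natrM !natr_Zp. Qed.

Lemma mulrn_Fp1 : e *+ (1%R : 'F_p) = e.
Proof. exact: (mulrn_Fp_nat 1). Qed.

Lemma mulrn_FpK a : a != 0 -> e *+ a *+ a^-1%R = e.
Proof. by move=> a0; rewrite -mulrn_FpM divff // mulrn_Fp1. Qed.

End FpMultiples.

(** By Fermat, a^p = a. This forces the diagonal entries of lambda_{e2} on the p-part to be 1. *)
Lemma Fp_expr_prime_eq1 p (a : 'F_p) : prime p -> a ^+ p = 1 -> a = 1.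
Proof. by move=> p_pr <-; have := expf_card a; rewrite card_Fp. Qed.

Section FpExponents.

Variables (gT : finGroupType) (p : nat) (x : gT).
Hypotheses (p_pr : prime p) (xp : (x ^+ p)%g = 1%g).
Implicit Types a b : 'F_p.

Lemma expg_Fp_nat n : (x ^+ (n%:R : 'F_p) = x ^+ n)%g.
Proof. by rewrite val_Fp_nat // expg_mod. Qed.

Lemma expg_FpD a b : (x ^+ (a + b)%R = x ^+ a * x ^+ b)%g.
Proof. by rewrite -[RHS]expgD -[RHS]expg_Fp_nat natrD !natr_Zp. Qed.

Lemma expg_FpM a b : (x ^+ (a * b)%R = x ^+ (a * b)%N)%g.
Proof. by rewrite -[RHS]expg_Fp_nat natrM !natr_Zp. Qed.

Lemma expg_Fp1 : (x ^+ (1%R : 'F_p) = x)%g.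
Proof. exact: (expg_Fp_nat 1). Qed.

End FpExponents.

(** * The action [lambda] and its kernel *)

Section BraceTheory.

Variable B : leftBraceType.
Implicit Types a b c : B.

Lemma circ_lambda a b : a ∘ b = a + lambda a b.
Proof. by rewrite /lambda addNKr. Qed.

Lemma lambdaD a b c : lambda a (b + c) = lambda a b + lambda a c.
Proof. by rewrite /lambda circDr -!addrA. Qed.

Lemma lambda0 a : lambda a 0 = 0.
Proof. by apply: (addrI (lambda a 0)); rewrite -lambdaD !addr0. Qed.

(** Each lambda_a is additive, so it fixes 0 and a o 0 = a; take for a the identity of o. *)
Lemma circ_oneE : circ_one = 0 :> B.
Proof. by rewrite -[RHS]circ1b circ_lambda lambda0 addr0. Qed.

(** This is associativity of o, with a o b cancelled additively. *)
Lemma lambda_circ a b c : lambda (a ∘ b) c = lambda a (lambda b c).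
Proof.
apply: (addrI (a ∘ b)); rewrite -circ_lambda -circA circ_lambda.
by rewrite [b ∘ c]circ_lambda lambdaD addrA -circ_lambda.
Qed.

Lemma lambda_0b b : lambda 0 b = b.
Proof. by rewrite -circ_oneE /lambda circ1b circ_oneE oppr0 add0r. Qed.

Lemma lambdaMn a b n : lambda a (b *+ n) = lambda a b *+ n.
Proof. by elim: n => [|n IHn]; rewrite ?lambda0 // !mulrS lambdaD IHn. Qed.

End BraceTheory.

Section LambdaKernel.

Variable B : finLeftBraceType.
Local Notation K := (lambda_ker B).
Implicit Types a b k : B.

Lemma lambda_kerP a : reflect (forall b, lambda a b = b) (a \in K).
Proof. by rewrite inE; apply: (iffP forallP) => h b; apply/eqP/h. Qed.

Lemma lambda_ker_circ k b : k \in K -> k ∘ b = k + b.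
Proof. by move=> /lambda_kerP Kk; rewrite circ_lambda Kk. Qed.

(** For k in K the sum k + b equals k o b, so lambda is constant on additive cosets of K. *)
Lemma lambda_kerDl k b c : k \in K -> lambda (k + b) c = lambda b c.
Proof.
by move=> Kk; rewrite -lambda_ker_circ // lambda_circ; apply/lambda_kerP.
Qed.

Lemma lambda_ker_group_set : group_set (K : {set B}).
Proof.
apply/group_setP; split; first by apply/lambda_kerP/lambda_0b.
move=> a b Ka /lambda_kerP Kb; apply/lambda_kerP => c.
by rewrite -[RHS]Kb; apply: lambda_kerDl.
Qed.
Canonical lambda_ker_group := Group lambda_ker_group_set.

(** The same set, now as a subgroup for the other group law on the carrier. *)
Lemma circ_lambda_ker_group_set : group_set (K : {set circ_group B}).
Proof.
apply/group_setP; split.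
  by apply/lambda_kerP => b; rewrite [1%g]circ_oneE lambda_0b.
move=> a b /lambda_kerP Ka /lambda_kerP Kb; apply/lambda_kerP => c.
by rewrite [LHS]lambda_circ Kb Ka.
Qed.
Definition circ_lambda_ker_group := Group circ_lambda_ker_group_set.

Lemma lambda_ker_conj a k :
  k \in K -> (a : circ_group B) ∘ k ∘ circ_inv a \in K.
Proof.
move=> /lambda_kerP Kk; apply/lambda_kerP => b.
rewrite !lambda_circ Kk -lambda_circ.
by rewrite [_ ∘ _](mulgV (a : circ_group B)) [1%g]circ_oneE lambda_0b.
Qed.

Lemma circ_lambda_ker_normal :
  (circ_lambda_ker_group <| [set: circ_group B])%g.
Proof.
apply/andP; split; first exact: subsetT.
apply/subsetP => a _; rewrite -groupV inE; apply/subsetP => _ /imsetP[k Kk ->].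
by rewrite /conjg invgK mulgA; apply: lambda_ker_conj.
Qed.

(** The element lambda_a(k) is the conjugate x = a o k o a^-1: as x lies in K, x + a = x o a = a o k
    = a + lambda_a(k). *)
Lemma lambda_ker_stable a k : k \in K -> lambda a k \in K.
Proof.
move=> Kk; have Kk' := lambda_ker_conj a Kk.
suff <- : a ∘ k ∘ circ_inv a = lambda a k by [].
apply: (addIr a); rewrite -lambda_ker_circ // -[LHS]circA circVb.
rewrite [_ ∘ circ_one](mulg1 (a ∘ k : circ_group B)).
by rewrite circ_lambda addrC.
Qed.

Lemma lambda_expg n a b :
  lambda ((a : circ_group B) ^+ n)%g b = iter n (lambda a) b.
Proof.
elim: n b => [|n IHn] b; first by rewrite [(_ ^+ 0)%g]circ_oneE lambda_0b.
by rewrite expgS [LHS]lambda_circ IHn.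
Qed.

(** The n-th power of a for o lies in the normal subgroup K of index n, so it acts trivially. *)
Lemma iter_lambda_index n a b :
  #|B| = (n * #|K|)%N -> iter n (lambda a) b = b.
Proof.
move=> oB; rewrite -lambda_expg; apply/lambda_kerP.
have idx : #|[set: circ_group B] : circ_lambda_ker_group|%g = n.
  have oBc : #|[set: circ_group B]| = (n * #|circ_lambda_ker_group|)%N.
    by rewrite cardsT.
  by rewrite -divgS ?subsetT // oBc mulnK // cardG_gt0.
have Ga := in_setT (a : circ_group B).
by have := mem_expg_indexg circ_lambda_ker_normal Ga; rewrite idx.
Qed.

End LambdaKernel.

(** * Coordinates adapted to the kernel *)

Section Coordinates.

Variables (B : finLeftBraceType) (p q : nat).
Hypotheses (p_pr : prime p) (q_pr : prime q) (neq_pq : p != q).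
Hypothesis oB : #|B| = (p * p * q)%N.
Hypothesis expB : forall x : B, x *+ (p * q) = 0.
Hypothesis oK : #|lambda_ker B| = (p * q)%N.
Local Notation K := (lambda_ker B).

Let co_pq : coprime p q.
Proof. by rewrite prime_coprime // dvdn_prime2. Qed.

Lemma lambda_ker_Fp_eq0 (e : B) (m : 'F_p) :
  e *+ p = 0 -> e \notin K -> e *+ m \in K -> m = 0.
Proof.
move=> ep /negP nKe Ke; apply/eqP/negPn/negP => m0; case: nKe.
rewrite -(mulrn_FpK p_pr ep m0).
exact: (groupX (G := lambda_ker_group B)).
Qed.

Lemma Fp_mulrn_eq0 (V : zmodType) l (e : V) (m : 'F_l) :
  prime l -> e *+ l = 0 -> e != 0 -> e *+ m = 0 -> m = 0.
Proof.
move=> l_pr ep e0 em; apply/eqP; apply: contraNT e0 => m0.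
by rewrite -(mulrn_FpK l_pr ep m0) em mul0rn.
Qed.

Lemma Cauchy_lambda_ker l :
  prime l -> (l %| p * q)%N -> exists2 e : B, e \in K & e *+ l = 0 /\ e != 0.
Proof.
move=> l_pr l_dvd; have [|e Ke oe] := @Cauchy B l (lambda_ker_group B) l_pr.
  by rewrite /= oK.
exists e => //; split; first by rewrite -FinRing.zmodXgE -oe expg_order.
by apply: contraTneq l_pr => e0; rewrite -oe e0 order1.
Qed.

(** For x outside K, q x is killed by p. Since p x lies in K, by the index, having q x in K as well
    would put x in K by Bezout. *)
Lemma p_torsion_notin_lambda_ker : exists2 e : B, e *+ p = 0 & e \notin K.
Proof.
have [x nKx] : exists x, x \notin K.
  apply/existsP; rewrite -negb_forall; apply/negP => /forallP allK.
  have : #|B| = #|K| by apply: eq_card => x; rewrite allK.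
  rewrite oB oK -mulnA => /eqP; rewrite -[X in _ == X]mul1n eqn_pmul2r.
    by rewrite eqn_leq leqNgt prime_gt1.
  by rewrite muln_gt0 !prime_gt0.
exists (x *+ q); first by rewrite -mulrnA mulnC expB.
apply: contra nKx => Kxq.
apply: (@mem_expg_coprime B (lambda_ker_group B) x p q) => //.
  exact: prime_gt0.
have <- : #|[set: B] : lambda_ker_group B|%g = p.
  by rewrite -divgS ?subsetT // cardsT oB oK -mulnA mulnK // muln_gt0 !prime_gt0.
apply: mem_expg_indexg; rewrite ?inE // -sub_abelian_normal ?subsetT //.
by apply/centsP => a _ b _; apply: addrC.
Qed.

Lemma brace_coordinates :
  exists (f : 'F_p * 'F_p * 'F_q -> B) (d : 'F_p) (c : 'F_q),
  [/\ bijective f, {morph f : x y / x + y}, c ^+ p = 1, ~ (d = 0 /\ c = 1)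
    & forall n m l s t u, f (n, m, l) ∘ f (s, t, u)
        = f (n + s + d * m * t, m + t, l + c ^+ m * u)].
Proof.
have [e1 K1 [p1 n1]] := Cauchy_lambda_ker p_pr (dvdn_mulr q (dvdnn p)).
have [e3 K3 [q3 n3]] := Cauchy_lambda_ker q_pr (dvdn_mull p (dvdnn q)).
have [e2 p2 K2] := p_torsion_notin_lambda_ker.
have KX (x : B) k : x \in K -> x *+ k \in K.
  exact: (groupX (G := lambda_ker_group B)).
have KD (x y : B) : x \in K -> (y + x \in K) = (y \in K).
  exact: (groupMr (G := lambda_ker_group B)).
pose f (x : 'F_p * 'F_p * 'F_q) := e1 *+ x.1.1 + e2 *+ x.1.2 + e3 *+ x.2.
have fD : {morph f : x y / x + y}.
  move=> x y; rewrite /f /= !mulrn_FpD //.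
  by rewrite [RHS]addrACA; congr (_ + _); apply: addrACA.
have fE n m l : f (n, m, l) = e1 *+ n + e2 *+ m + e3 *+ l by [].
have f12 n m : f (n, m, 0) = e1 *+ n + e2 *+ m by rewrite /f /= addr0.
have f0 : f 0 = 0 by apply: (addrI (f 0)); rewrite -fD !addr0.
have fN x : f (- x) = - f x by apply: (addrI (f x)); rewrite -fD !subrr.
(* In these coordinates K is m = 0, the p-torsion lies in l = 0 and the q-torsion in n = m = 0. *)
have Kf x : (f x \in K) = (x.1.2 == 0).
  rewrite /f (KD _ _ (KX _ _ K3)) addrC (KD _ _ (KX _ _ K1)).
  apply/idP/eqP => [|->].
    exact: lambda_ker_Fp_eq0.
  exact: (group1 (lambda_ker_group B)).
have tors x : f x *+ p = 0 -> x.2 = 0.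
  rewrite /f !mulrnDl -!mulrnA ![(_ * p)%N]mulnC !mulrnA p1 p2 !mul0rn !add0r.
  rewrite -mulrnA mulnC mulrnA => e; apply: (Fp_mulrn_eq0 q_pr q3 n3).
  apply: (mulrn_coprime_eq0 (prime_gt0 p_pr) co_pq e).
  by rewrite -mulrnA mulnC mulrnA q3 mul0rn.
have qtors x : f x *+ q = 0 -> x.1 = 0.
  case: x => [[n m] l] /= e.
  have : f (n, m, 0) = 0.
    apply: (@mulrn_coprime_eq0 _ _ p q) => //; first exact: prime_gt0.
      rewrite f12 mulrnDl -!mulrnA ![(_ * p)%N]mulnC !mulrnA.
      by rewrite p1 p2 !mul0rn addr0.
    have e3lq : e3 *+ l *+ q = 0 by rewrite -mulrnA mulnC mulrnA q3 mul0rn.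
    by rewrite -[RHS]e f12 -[LHS]addr0 -e3lq -mulrnDl.
  move=> e0; have m0 : m = 0.
    apply/eqP; rewrite -(Kf (n, m, 0)) e0.
    exact: (group1 (lambda_ker_group B)).
  move: e0; rewrite f12 m0 addr0 => e0; congr (_, _).
  exact: (Fp_mulrn_eq0 p_pr p1 n1 e0).
(* An element of the kernel of [f] is both p-torsion and q-torsion. *)
have f_inj : injective f.
  move=> x y /eqP; rewrite -subr_eq0 -fN -fD => /eqP e; apply/subr0_eq.
  rewrite [LHS]surjective_pairing tors ?qtors ?e ?mul0rn //.
have f_bij : bijective f.
  apply: inj_card_bij => //.
  by rewrite !card_prod !card_Fp // oB.
have [g gK fK] := f_bij.
have f1 n : f (n, 0, 0) = e1 *+ n by rewrite f12 addr0.
have f2 m : f (0, m, 0) = e2 *+ m by rewrite f12 add0r.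
have f3 l : f (0, 0, l) = e3 *+ l by rewrite /f /= !add0r.
pose mu := lambda e2.
(* The image of e1 lies in K and is p-torsion, hence a multiple of e1; for e2 only the torsion
   condition is available, whence the extra entry d. *)
have [a mu1] : exists a : 'F_p, mu e1 = e1 *+ a.
  have := @tors (g (mu e1)); have := Kf (g (mu e1)).
  rewrite fK -lambdaMn p1 lambda0 lambda_ker_stable //.
  case: (g _) (fK (mu e1)) => [[n m] l] /= <- /esym/eqP-> ->//.
  by exists n; rewrite f1.
have [d [b mu2]] : exists d b, mu e2 = f (d, b, 0).
  have := @tors (g (mu e2)).
  rewrite fK -lambdaMn p2 lambda0.
  case: (g _) (fK (mu e2)) => [[n m] l] /= <- ->//.
  by exists n, m.
have [c mu3] : exists c : 'F_q, mu e3 = e3 *+ c.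
  have := @qtors (g (mu e3)).
  rewrite fK -lambdaMn q3 lambda0.
  case: (g _) (fK (mu e3)) => [[n m] l] /= <- /(_ erefl)[-> ->].
  by exists l; rewrite f3.
have muf n m l : mu (f (n, m, l)) = f (a * n + d * m, b * m, c * l).
  rewrite !fE /mu !lambdaD !lambdaMn -/mu mu1 mu2 mu3 f12 mulrnDl.
  by rewrite mulrn_FpD // !mulrn_FpM // !addrA.
have mu_p x : iter p mu x = x by apply: iter_lambda_index; rewrite oB oK mulnA.
have a1 : a = 1.
  apply: (Fp_expr_prime_eq1 p_pr).
  have it k : iter k mu (f (1, 0, 0)) = f (a ^+ k, 0, 0).
    elim: k => // k IHk; rewrite iterS IHk muf !mulr0 addr0 -exprS.
    by [].
  by have := it p; rewrite mu_p => /f_inj[].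
(* The first coordinate stays unspecified: its simple closed form comes once a = b = 1. *)
have iter_mu k n m l : exists n',
    iter k mu (f (n, m, l)) = f (n', b ^+ k * m, c ^+ k * l).
  elim: k => [|k [n' IHk]]; first by exists n; rewrite !expr0 !mul1r.
  by eexists; rewrite iterS IHk muf !mulrA -!exprS.
have b1 : b = 1.
  apply: (Fp_expr_prime_eq1 p_pr); have [n'] := iter_mu p 0 1 0.
  by rewrite mu_p mulr1 => /f_inj/(congr1 (fun x => x.1.2)).
have cp1 : c ^+ p = 1.
  have [n'] := iter_mu p 0 0 1.
  by rewrite mu_p !mulr1 => /f_inj/(congr1 snd).
have{iter_mu a1 b1 muf} muf n m l : mu (f (n, m, l)) = f (n + d * m, m, c * l).
  by rewrite muf a1 b1 !mul1r.
have iter_mu k n m l :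
    iter k mu (f (n, m, l)) = f (n + d * k%:R * m, m, c ^+ k * l).
  elim: k => [|k IHk]; first by rewrite mulr0 mul0r addr0 mul1r.
  by rewrite iterS IHk muf exprS -!mulrA; congr (f (_, _, _)); ring.
have lambda_e2 k x : lambda (f (0, k%:R, 0)) x = iter k mu x.
  elim: k x => [|k IHk] x; first by rewrite f0 lambda_0b.
  have fe2 : f (0, 1, 0) = e2 by rewrite f2 mulrn_Fp1.
  (* Modulo K, (k+1) e2 is e2 o (k e2); the correction -d k e1 lies in K and does not affect
     lambda. *)
  have -> : f (0, k.+1%:R, 0) = f (- (d * k%:R), 0, 0) + e2 ∘ f (0, k%:R, 0).
    rewrite circ_lambda -/mu muf -[X in _ = _ + (X + _)]fe2 -!fD.
    congr (f (_, _, _)) => /=.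
    - by rewrite !add0r addNr.
    - by rewrite add0r -natr1 addrC.
    - by rewrite mulr0 !addr0.
  by rewrite lambda_kerDl ?Kf // lambda_circ IHk iterS.
exists f, d, c; split=> // [[d0 c1]|n m l s t u].
  (* If d = 0 and c = 1, lambda_{e2} is the identity and e2 would lie in K. *)
  case/negP: K2; apply/lambda_kerP => x.
  rewrite -(fK x); case: (g x) => [[n m] l].
  by rewrite -/mu muf d0 c1 mul0r mul1r addr0.
rewrite circ_lambda.
have -> : f (n, m, l) = f (n, 0, l) + f (0, m, 0).
  by rewrite -fD; congr (f (_, _, _)); rewrite /= ?addr0 ?add0r.
rewrite lambda_kerDl ?Kf // -[X in lambda (f (_, X, _))]natr_Zp lambda_e2.
rewrite iter_mu natr_Zp -!fD; congr (f (_, _, _)) => /=; ring.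
Qed.

End Coordinates.

(** * Transport of properties along isomorphisms *)

Lemma inj_morph_isog (gT rT : finGroupType) (f : gT -> rT) :
  injective f -> {morph f : x y / (x * y)%g} -> (#|rT| <= #|gT|)%N ->
  ([set: gT] \isog [set: rT])%g.
Proof.
move=> f_inj fM le_rg; pose fm := Morphism (D := [set: gT]%g) (in2W fM).
apply/isogP; exists fm; first by apply/injmP => x y _ _; apply: f_inj.
apply/eqP; rewrite eqEcard subsetT /= morphimEdom card_imset //.
by rewrite !cardsT.
Qed.

Section BraceIso.

Implicit Types B C : leftBraceType.

Lemma brace_isog_sym B C : brace_isog B C -> brace_isog C B.
Proof.
move=> [f [[g gK fK] fD fM]]; exists g; split; first by exists f.
  by move=> a b; apply: (can_inj gK); rewrite fD !fK.
by move=> a b; apply: (can_inj gK); rewrite fM !fK.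
Qed.

Lemma brace_isog_commutative B C :
  brace_isog B C -> commutative (@circ B) -> commutative (@circ C).
Proof.
move=> [f [[g _ fK] _ fM]] cB a b.
by rewrite -(fK a) -(fK b) -!fM cB.
Qed.

(** The condition says that every lambda_a fixes the n-torsion pointwise, and isomorphisms carry
    n-torsion to n-torsion. *)
Lemma brace_isog_torsion B C n :
  brace_isog B C ->
  (forall a b : B, b *+ n = 0 -> a ∘ b = a + b) ->
  (forall a b : C, b *+ n = 0 -> a ∘ b = a + b).
Proof.
move=> iso tB a b bn; case: iso => [f [[g gK fK] fD fM]].
have f0 : f 0 = 0 by apply: (addrI (f 0)); rewrite -fD !addr0.
rewrite -(fK a) -(fK b) -fM -fD tB //; apply: (can_inj gK).
have fMn x k : f (x *+ k) = f x *+ k.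
  by elim: k => [|k IHk]; rewrite ?f0 // !mulrS fD IHk.
by rewrite fMn fK bn f0.
Qed.

End BraceIso.

(** * The braces B_ij: kernel, invariants and multiplicative groups *)

Lemma mulrn_Fp p (a : 'F_p) : prime p -> a *+ p = 0.
Proof. by move=> p_pr; rewrite -mulr_natr pchar_Fp_0 // mulr0. Qed.

Section BraceB.

Variables (p q : nat) (p_pr : prime p) (q_pr : prime q).
Variables (r : {unit 'F_q}) (r_order : #[r]%g = p).
Local Notation Bij := (braceB p_pr r_order).
Implicit Types i j : nat.

Lemma braceB_circE i j n m l s t u :
  ((n, m, l) : Bij i j) ∘ ((s, t, u) : Bij i j)
    = (n + s + (m * t) *+ j, m + t, l + val (r ^+ (i * m))%g * u).
Proof. by []. Qed.

Lemma braceB_lambdaE i j n m l s t u :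
  lambda ((n, m, l) : Bij i j) ((s, t, u) : Bij i j)
    = (s + (m * t) *+ j, t, val (r ^+ (i * m))%g * u).
Proof.
by rewrite /lambda braceB_circE; congr (_, _, _); rewrite /= ?addrA ?addNr ?add0r.
Qed.

Lemma braceB_mulrn i j n m l k :
  ((n, m, l) : Bij i j) *+ k = (n *+ k, m *+ k, l *+ k).
Proof. by elim: k => [|k IHk]; rewrite ?mulr0n // !mulrS IHk. Qed.

Lemma card_braceB i j : #|Bij i j| = (p * p * q)%N.
Proof. by rewrite !card_prod !card_Fp. Qed.

Lemma expg_r_eq (a b : nat) :
  a%:R = b%:R :> 'F_p -> (r ^+ a = r ^+ b)%g.
Proof.
move=> e; apply/eqP; rewrite eq_expg_mod_order r_order.
by rewrite -!val_Fp_nat // e.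
Qed.

Lemma expg_r_eq1 (m : 'F_p) : (r ^+ m = 1)%g -> m = 0.
Proof.
move/eqP; rewrite -order_dvdn r_order => dm; apply: val_inj => /=.
apply/eqP; rewrite -[X in X == _](modn_small (d := p)).
  exact: dm.
by have := ltn_ord m; rewrite [X in (_ < X)%N]Fp_cast.
Qed.

Lemma braceB_add_isog i j :
  [set: Bij i j]%g \isog [set: 'F_p * 'F_p * 'F_q]%g.
Proof. by apply: (@inj_morph_isog _ _ (fun x : Bij i j => x)). Qed.

Lemma braceB_lambda_ker i j : (i, j) <> (0, 0)%N -> (i <= 1)%N -> (j <= 1)%N ->
  #|lambda_ker (Bij i j)| = (p * q)%N.
Proof.
move=> ij0 i1 j1.
have -> : lambda_ker (Bij i j) = setX (setX setT [set 0]) setT.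
  apply/setP => [[[n m] l]]; rewrite !in_setX !in_setT in_set1 andbT /=.
  apply/lambda_kerP/eqP => [h|-> [[s t] u]]; last first.
    by rewrite braceB_lambdaE mul0r mul0rn addr0 muln0 mul1r.
  (* If j = 1, the vector (0,1,0) gives m = 0; if j = 0 and i = 1, the vector (0,0,1) gives r^m =
     1. *)
  case: j j1 ij0 h => [|[|//]] _ ij0 h; last first.
    have := h (0, 1, 0); rewrite braceB_lambdaE add0r mulr1.
    by move/(congr1 (fun x => x.1.1)).
  case: i i1 ij0 h => [|[|//]] _ // _ h.
  apply: expg_r_eq1; apply: val_inj.
  have := h (0, 0, 1); rewrite braceB_lambdaE mul1n mulr1.
  by move/(congr1 snd).
by rewrite !cardsX cards1 !cardsT !card_Fp // muln1.
Qed.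

(** For i = 1 the two products of (0,1,0) and (0,0,1) have last coordinates r and 1; for i = 0 the
    cocycle j m t is symmetric. *)
Lemma braceB_commutative i j : (i <= 1)%N ->
  commutative (@circ (Bij i j)) <-> i = 0%N.
Proof.
move=> i1; split=> [cB|->] .
  case: i i1 cB => [|[|//]] // _ cB.
  have : 0 + val (r ^+ (1 * (1 : 'F_p)%R))%g * 1
      = 1 + val (r ^+ (1 * (0 : 'F_p)%R))%g * 0 :> 'F_q.
    exact: (congr1 (fun x : 'F_p * 'F_p * 'F_q => x.2) (cB (0, 1, 0) (0, 0, 1))).
  rewrite add0r mulr0 addr0 mulr1 mul1n => e.
  have : (r ^+ (1 : 'F_p)%R)%g = 1%g by apply: val_inj.
  by move/expg_r_eq1/eqP; rewrite oner_eq0.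
move=> [[n m] l] [[s t] u]; rewrite !braceB_circE !mul0n !mul1r.
by congr (_, _, _); rewrite ?[m * t]mulrC ?[n + s]addrC // addrC.
Qed.

(** The p-torsion is u = 0, where lambda only adds j m t to the first coordinate; for j = 1 the
    vector (0,1,0) acts non-trivially on itself. *)
Lemma braceB_torsion i j : p != q -> (j <= 1)%N ->
  (forall a b : Bij i j, b *+ p = 0 -> a ∘ b = a + b) <-> j = 0%N.
Proof.
move=> neq_pq j1; split=> [tB|->].
  case: j j1 tB => [|[|//]] // _ tB.
  have := tB (0, 1, 0) (0, 1, 0).
  rewrite braceB_circE => /(_ _)/(congr1 (fun x => x.1.1)) e.
  have : (0 : 'F_p) + 0 + 1 * 1 = 0 + 0.
    by apply: e; rewrite braceB_mulrn !mulrn_Fp // mul0rn.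
  by rewrite mul1r !add0r => /eqP; rewrite oner_eq0.
move=> [[n m] l] [[s t] u] tp; rewrite braceB_circE.
have -> : u = 0.
  apply: (@mulrn_coprime_eq0 _ u p q); rewrite ?mulrn_Fp ?prime_gt0 //.
    by rewrite prime_coprime // dvdn_prime2.
  by move: tp; rewrite braceB_mulrn => /(congr1 (fun x => x.2)).
by rewrite mulr0n mulr0 addr0.
Qed.

Lemma cocycle_split (F : fieldType) (x y u v : F) j : 2%:R != 0 :> F ->
  x + y + (u * v) *+ j - ((u + v) * (u + v) / 2%:R) *+ j
    = (x - (u * u / 2%:R) *+ j) + (y - (v * v / 2%:R) *+ j).
Proof.
(* The multiplicity [j] becomes an opaque scalar, so that [field] can conclude. *)
move=> nz2; have [c mulrnE] : exists c, forall z : F, z *+ j = z * c.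
  by exists j%:R => z; rewrite mulr_natr.
by rewrite !mulrnE; field.
Qed.

Lemma shear_inj (U : zmodType) (V W : Type) (h : V -> U) :
  injective (fun x : U * V * W => (x.1.1 - h x.1.2, x.1.2, x.2)).
Proof.
move=> [[n m] l] [[s t] u] [/= e em ->].
by move: e; rewrite em => /addIr->.
Qed.

(** The shear n -> n - j m^2/2 absorbs the cocycle. It respects o but is in general not additive, so
    it does not identify the braces. *)
Lemma circ_braceB_isog i j : (2 < p)%N ->
  ([set: circ_group (Bij i j)] \isog [set: circ_group (Bij i 0)])%g.
Proof.
move=> p_gt2.
have nz2 : (2%:R : 'F_p) != 0.
  apply/eqP => /(congr1 (@nat_of_ord _)); rewrite val_Fp_nat // modn_small //.
pose f (x : Bij i j) : Bij i 0 :=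
  (x.1.1 - (x.1.2 * x.1.2 / 2%:R) *+ j, x.1.2, x.2).
apply: (@inj_morph_isog _ _ (f : circ_group (Bij i j) -> circ_group (Bij i 0))).
- exact: (@shear_inj 'F_p 'F_p 'F_q (fun m => (m * m / 2%:R) *+ j)).
- move=> [[n m] l] [[s t] u].
  rewrite [LHS]/f [RHS]braceB_circE; congr (_, _, _).
  by rewrite mulr0n addr0; apply: cocycle_split.
- by rewrite !card_braceB.
Qed.

Lemma circ_braceB00_isog :
  ([set: circ_group (Bij 0 0)] \isog [set: 'F_p * 'F_p * 'F_q])%g.
Proof.
pose f (x : circ_group (Bij 0 0)) : 'F_p * 'F_p * 'F_q := x.
apply: (@inj_morph_isog _ _ f).
- by move=> x y.
- move=> [[n m] l] [[s t] u]; rewrite [LHS]/f [X in X = _]braceB_circE mulr0n addr0.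
  by rewrite mul0n expg0 mul1r.
- exact: (leqnn #|Bij 0 0|).
Qed.

End BraceB.

(** * Classification by rescaling the basis *)

Lemma add_isog_exponent (B : finLeftBraceType) (p q : nat) :
  prime p -> prime q ->
  [set: B]%g \isog [set: 'F_p * 'F_p * 'F_q]%g ->
  #|B| = (p * p * q)%N /\ forall x : B, x *+ (p * q) = 0.
Proof.
move=> p_pr q_pr iso; split.
  rewrite -[LHS]cardsT (card_isog iso) cardsT.
  have <- : #|{: 'F_p * 'F_p * 'F_q}| = (p * p * q)%N.
    by rewrite !card_prod !card_Fp.
  exact: erefl.
move=> x; case/isogP: iso => f f_inj _.
have f_x : (f x ^+ (p * q))%g = 1%g.
  case: (f x) => [[n m] l]; rewrite [LHS](_ : _ = (n, m, l) *+ (p * q)) //.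
  rewrite (_ : _ *+ _ = (n *+ (p * q), m *+ (p * q), l *+ (p * q))).
    by rewrite [in l *+ _]mulnC !mulrnA !mulrn_Fp // !mul0rn.
  by elim: (p * q)%N => // k IHk; rewrite !mulrS IHk.
apply: (injmP f_inj); rewrite ?in_setT //.
by rewrite -[_ *+ _]FinRing.zmodXgE morphX ?in_setT // f_x -[0]/1%g morph1.
Qed.

Section Classification.

Variables (p q : nat) (p_pr : prime p) (q_pr : prime q).
Variables (r : {unit 'F_q}) (r_order : #[r]%g = p).
Local Notation Bij := (braceB p_pr r_order).

(** This makes every p-th root of unity in ['F_q], in particular c, a power of r. *)
Lemma p_primitive_r : p.-primitive_root (val r).
Proof.
have rp : val r ^+ p = 1 by rewrite -FinRing.val_unitX -r_order expg_order.
have [m prim_m dvd_mp] := prim_order_exists (prime_gt0 p_pr) rp.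
suff /eqP <- : m == p by [].
rewrite eqn_dvd dvd_mp -{1}r_order order_dvdn; apply/eqP/val_inj.
by rewrite FinRing.val_unitX prim_expr_order.
Qed.

(** Replacing e1, e2 by x e1, y e2 turns the cocycle d m t into (d y^2 / x) m t and c into c^y; the
    hypotheses ask that these be j m t and r^i. *)
Lemma brace_isog_rescale (B : leftBraceType) (f : 'F_p * 'F_p * 'F_q -> B)
    (d x y : 'F_p) (c : 'F_q) (i j : nat) :
  bijective f -> {morph f : a b / a + b} ->
  (forall n m l s t u, f (n, m, l) ∘ f (s, t, u)
     = f (n + s + d * m * t, m + t, l + c ^+ m * u)) ->
  x != 0 -> y != 0 -> x *+ j = d * y * y ->
  (forall m : 'F_p, c ^+ (y * m)%R = val (r ^+ (i * m))%g) ->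
  brace_isog B (Bij i j).
Proof.
move=> f_bij fD fM x0 y0 xj cy; apply: brace_isog_sym.
exists (fun a : 'F_p * 'F_p * 'F_q => f (x * a.1.1, y * a.1.2, a.2)); split.
- apply: (bij_comp f_bij).
  exists (fun a : 'F_p * 'F_p * 'F_q => (x^-1 * a.1.1, y^-1 * a.1.2, a.2)).
    by move=> [[n m] l]; rewrite /= !mulKf.
  by move=> [[n m] l]; rewrite /= !mulVKf.
- move=> [[n m] l] [[s t] u]; rewrite -fD; congr (f (_, _, _)).
    exact: mulrDr.
  exact: mulrDr.
- move=> [[n m] l] [[s t] u]; rewrite braceB_circE fM.
  congr (f (_, _, _)); last by rewrite cy.
    rewrite [LHS]mulrDr [x * (n + s)]mulrDr mulrnAr -mulrnAl xj.
    by congr (_ + _ + _); rewrite /=; ring.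
  exact: mulrDr.
Qed.

Lemma brace_classification (B : finLeftBraceType) : p != q ->
  [set: B]%g \isog [set: 'F_p * 'F_p * 'F_q]%g ->
  #|lambda_ker B| = (p * q)%N ->
  exists i j : nat, [/\ (i <= 1)%N, (j <= 1)%N, (i, j) <> (0, 0)%N
    & brace_isog B (Bij i j)].
Proof.
move=> neq_pq iso oK; have [oB expB] := add_isog_exponent p_pr q_pr iso.
have [f [d [c [f_bij fD cp dc fM]]]] :=
  brace_coordinates p_pr q_pr neq_pq oB expB oK.
have rescale := brace_isog_rescale f_bij fD fM.
have [k ck] := prim_rootP p_primitive_r cp.
have [k0|k_neq0] := eqVneq (nat_of_ord k) 0%N.
  have c1 : c = 1 by rewrite ck k0 expr0.
  have d0 : d != 0 by apply/eqP => d0; apply: dc.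
  exists 0%N, 1%N; split=> //; apply: (rescale d 1) => //.
  - by rewrite !mulr1.
  - by move=> m; rewrite c1 expr1n.
(* With c = r^k, the exponent 1/k mod p turns c into r, so i = 1; then x = d y^2 makes j = 1 when d
   is non-zero. *)
pose y : 'F_p := k%:R^-1.
have ky0 : (k%:R : 'F_p) != 0.
  apply: contraNneq k_neq0 => /(congr1 (@nat_of_ord _)).
  by rewrite val_Fp_nat // modn_small // => ->.
have y0 : y != 0 by rewrite invr_eq0.
have cy m : c ^+ (y * m)%R = val (r ^+ (1 * m))%g.
  rewrite ck -exprM -FinRing.val_unitX mul1n; congr val.
  apply: (expg_r_eq p_pr r_order); rewrite natrM !natr_Zp /y.
  by rewrite mulVKf.
have [d0|d0] := eqVneq d 0.
  exists 1%N, 0%N; split=> //; apply: (rescale 1 y) => //.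
  by rewrite d0 !mul0r.
exists 1%N, 1%N; split=> //; apply: (rescale (d * y * y) y) => //.
by rewrite !mulf_neq0.
Qed.

(** * The presentation of the multiplicative group for i = 1 *)

Lemma circ_braceB10_Grp :
  ([set: circ_group (Bij 1 0)] \isog
     Grp (s : t : e : s ^+ p, t ^+ p, e ^+ q, [~ e, t], [~ t, s],
          s * e * s^-1 = e ^+ nat_of_ord (val r)))%g.
Proof.
pose G := circ_group (Bij 1 0).
have ME n m l s t u : (((n, m, l) : G) * ((s, t, u) : G))%g
    = (n + s, m + t, l + val r ^+ m * u).
  rewrite [LHS]braceB_circE mulr0n addr0 mul1n.
  by rewrite FinRing.val_unitX.
have Xt n k : (((n, 0, 0) : G) ^+ k)%g = (n *+ k, 0, 0).
  by elim: k => // k IHk; rewrite expgS IHk ME mulr0 !addr0 mulrS.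
have Xs m k : (((0, m, 0) : G) ^+ k)%g = (0, m *+ k, 0).
  by elim: k => // k IHk; rewrite expgS IHk ME mulr0 !addr0 mulrS.
have Xe l k : (((0, 0, l) : G) ^+ k)%g = (0, 0, l *+ k).
  by elim: k => // k IHk; rewrite expgS IHk ME mul1r !addr0 mulrS.
apply: intro_isoGrp => [|rT H].
  have [s [t [e [gen [sp tp eq] cet cts se]]]] : exists s t e : G,
    [/\ [set: G] \subset (<[s]> <*> <[t]> <*> <[e]>)%G,
        [/\ s ^+ p = 1, t ^+ p = 1 & e ^+ q = 1], commute e t, commute t s
      & s * e = e ^+ nat_of_ord (val r) * s]%g.
    (* The basis vectors satisfy the relations and generate, since each element is t^n e^l s^m. *)
    pose s : G := (0, 1, 0); pose t : G := (1, 0, 0); pose e : G := (0, 0, 1).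
    exists s, t, e; split.
    - apply/subsetP => [[[n m] l]] _.
      have -> : (n, m, l) = (t ^+ n * e ^+ l * s ^+ m)%g.
        by rewrite Xt Xe Xs !ME !natr_Zp mul1r !mulr0 !addr0 !add0r.
      have memX (A : {group G}) (x : G) k : (<[x]> \subset A -> x ^+ k \in A)%g.
        by move=> sxA; apply/(subsetP sxA)/mem_cycle.
      apply: groupM; last first.
        by apply: memX; apply: subset_trans (joing_subl _ _); apply: joing_subl.
      apply: groupM; last by apply: memX; apply: joing_subr.
      by apply: memX; apply: subset_trans (joing_subl _ _); apply: joing_subr.
    - by rewrite Xs Xt Xe !mulrn_Fp.
    - by rewrite /commute !ME !mulr0 !mul1r !addr0 !add0r.
    - by rewrite /commute !ME !mulr0 !addr0 !add0r.
    - rewrite Xe natr_Zp !ME !mulr0 !addr0 !add0r mulr1 -FinRing.val_unitX.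
      congr (_, _, val _); exact: (expg_r_eq p_pr r_order).
  apply/existsP; exists (s, t, e); apply/eqP; rewrite /= sp tp eq se mulgK.
  move/commgP/eqP: cet => ->; move/commgP/eqP: cts => ->.
  by congr (_, _); apply/eqP; rewrite eqEsubset subsetT.
case/existsP => -[[s t] e] /= /eqP[defH sp tp eq].
move=> /eqP/commgP cet /eqP/commgP cts.
rewrite -[FinRing.uval r]/(val r) => se.
(* Conversely, this normal form defines a map onto any group [H] generated by elements satisfying
   the relations. *)
pose phi (x : G) := (t ^+ x.1.1 * e ^+ x.2 * s ^+ x.1.2)%g.
have phiE n m l : phi (n, m, l) = (t ^+ n * e ^+ l * s ^+ m)%g by [].
(* Iterating s e s^-1 = e^r moves powers of s past powers of e, which is what multiplicativity of
   [phi] requires. *)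
have eJ k (l : 'F_q) :
    (s ^+ k * e ^+ l)%g = (e ^+ (val r ^+ k * l)%R * s ^+ k)%g.
  elim: k => [|k IHk]; first by rewrite mul1r !expg0 mul1g mulg1.
  rewrite expgS -mulgA IHk exprS -mulrA [in RHS]expg_FpM //.
  rewrite [in RHS]expgM -se.
  have := conjXg e s^-1%g (val r ^+ k * l)%R.
  by rewrite !conjgE invgK !mulgA => <-; rewrite mulgKV.
have phiM : {in [set: G] &, {morph phi : x y / (x * y)%g}}.
  move=> [[n m] l] [[n' m'] l'] _ _; rewrite ME !phiE !expg_FpD //.
  have ctX i a : commute (t ^+ i)%g (s ^+ a)%g by apply/commuteX2.
  have cteX i a : commute (t ^+ i)%g (e ^+ a)%g by apply/commuteX2/commute_sym.
  rewrite !mulgA -[in RHS](mulgA _ (s ^+ m) (t ^+ n'))%g -ctX !mulgA.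
  rewrite -[in RHS](mulgA _ (e ^+ l) (t ^+ n'))%g -cteX !mulgA.
  by rewrite -[in RHS](mulgA _ (s ^+ m) (e ^+ l'))%g eJ !mulgA.
apply/homgP; exists (Morphism phiM); apply/eqP; rewrite eqEsubset.
have : (<[s]> <*> <[t]> <*> <[e]> \subset H)%g by rewrite defH.
rewrite !join_subG !cycle_subG => /andP[/andP[Hs Ht] He].
apply/andP; split.
  by apply/subsetP => _ /morphimP[x _ _ ->] /=; rewrite !groupM ?groupX.
have gen x y : phi x = y -> y \in (Morphism phiM @* [set: G])%g.
  by move<-; apply: (mem_morphim (Morphism phiM)); rewrite in_setT.
rewrite -{1}defH !join_subG !cycle_subG -andbA; apply/and3P; split.
- apply: (gen (0, 1, 0)); rewrite phiE.
  by rewrite expg_Fp1 // !mul1g.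
- apply: (gen (1, 0, 0)); rewrite phiE.
  by rewrite expg_Fp1 // !mulg1.
- apply: (gen (0, 0, 1)); rewrite phiE.
  by rewrite expg_Fp1 // mul1g mulg1.
Qed.

End Classification.

Local Close Scope brace_scope.
Local Close Scope ring_scope.

Lemma leq1_eq0_inj m n : m <= 1 -> n <= 1 -> (m = 0 <-> n = 0) -> m = n.
Proof.
case: m n => [|[|//]] [|[|//]] _ _ [mn nm] //; first exact: esym (mn erefl).
exact: (nm erefl).
Qed.

Theorem proposition5p3 (p q : nat) (p_pr : prime p) (q_pr : prime q)
    (p_gt2 : 2 < p) (q_mod_p : q = 1 %[mod p]) (q_mod_p2 : q <> 1 %[mod p ^ 2])
    (r : {unit 'F_q}) (r_order : #[r]%g = p) :
  [/\ forall i j : nat, i <= 1 -> j <= 1 -> (i, j) <> (0, 0) ->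
        [set: braceB p_pr r_order i j]%g \isog [set: 'F_p * 'F_p * 'F_q]%g
        /\ #|lambda_ker (braceB p_pr r_order i j)| = p * q,
      forall B : finLeftBraceType,
        [set: B]%g \isog [set: 'F_p * 'F_p * 'F_q]%g ->
        #|lambda_ker B| = p * q ->
        exists i j : nat, [/\ i <= 1, j <= 1, (i, j) <> (0, 0)
          & brace_isog B (braceB p_pr r_order i j)],
      forall i j k l : nat, i <= 1 -> j <= 1 -> (i, j) <> (0, 0) ->
        k <= 1 -> l <= 1 -> (k, l) <> (0, 0) -> (i, j) <> (k, l) ->
        ~ brace_isog (braceB p_pr r_order i j) (braceB p_pr r_order k l),
      [set: circ_group (braceB p_pr r_order 0 1)]%g
        \isog [set: 'F_p * 'F_p * 'F_q]%g
    & forall i j : nat, i <= 1 -> j <= 1 -> (i, j) <> (0, 0) ->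
        (i, j) <> (0, 1) ->
        ([set: circ_group (braceB p_pr r_order i j)] \isog
           Grp (s : t : e : s ^+ p, t ^+ p, e ^+ q, [~ e, t], [~ t, s],
                s * e * s^-1 = e ^+ nat_of_ord (val r)))%g].
Proof.
(* The residue of q mod p is 1, while that of p is 0. *)
have neq_pq : p != q.
  apply/eqP => pq; move: q_mod_p; rewrite -pq modnn modn_small //.
  exact: prime_gt1.
split.
- move=> i j i1 j1 ij0; split; first exact: braceB_add_isog.
  exact: braceB_lambda_ker.
- by move=> B; apply: brace_classification.
- move=> i j k l i1 j1 _ k1 l1 _ ijkl iso; apply: ijkl.
  have iso' := brace_isog_sym iso.
  have ik : i = 0 <-> k = 0.
    rewrite -(braceB_commutative p_pr r_order j i1).
    rewrite -(braceB_commutative p_pr r_order l k1).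
    by split; apply: brace_isog_commutative.
  have jl : j = 0 <-> l = 0.
    rewrite -(braceB_torsion p_pr q_pr r_order i neq_pq j1).
    rewrite -(braceB_torsion p_pr q_pr r_order k neq_pq l1).
    by split; apply: brace_isog_torsion.
  by congr (_, _); apply: leq1_eq0_inj.
- apply: isog_trans (circ_braceB_isog p_pr q_pr r_order 0 1 p_gt2) _.
  exact: circ_braceB00_isog.
(* Only i = 1 remains, and the shear reduces j to 0. *)
- move=> i j i1 j1 ij0 ij1; have -> : i = 1.
    by case: i j i1 j1 ij0 ij1 => [|[|//]] [|[|//]].
  apply: isoGrp_trans (circ_braceB_isog p_pr q_pr r_order 1 j p_gt2) _.
  exact: circ_braceB10_Grp.
Qed.
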